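(* Let $p/q$ be an even rational parameter, $\omega=p+q$, and let $B$ be any block. For each even integer $k\in[0,\omega]$ there are exactly $2$ lines of $\mathcal H$ and exactly $2$ lines of $\mathcal V$ which have capacity $k$ and intersect $B$. Each such line $L$ carries exactly $k$ light points in $B$ (i.e. the light count of $L\cap B$ equals $k$).
   Context: An even rational parameter is a rational $p/q\in(0,1)$, $p,q$ positive coprime integers, with $pq$ even. Put $\omega=p+q$, $P=2p/\omega$, $Q=2q/\omega$. Families of lines: $\mathcal H$ = lines $y=n$, $\mathcal V$ = lines $x=n$ ($n\in\mathbb Z$), $\mathcal P$ = lines of slope $-P$ with integer $y$-intercept, $\mathcal Q$ = lines of slope $-Q$ with integer $y$-intercept. Functions mod $2\mathbb Z$, values represented in $(-1,1]$: $F_H(x,y)=2Py$, $F_V(x,y)=2Px$, $F_P(x,y)=Py+P^2x+1$, $F_Q(x,y)=Py+PQx+1$. The capacity of a line $L\in\mathcal H$ (resp. $\mathcal V$) is $|\omega F_H(L)|$ (resp. $|\omega F_V(L)|$), these functions being constant on such lines. A unit segment is an edge of a unit square of the integer grid; horizontal ones lie on lines of $\mathcal H$ (set $A=H$), vertical ones on lines of $\mathcal V$ (set $A=V$). A point $z$ of a unit segment $s$ is a light point of $s$ if for some $B\in\{P,Q\}$, $z$ lies on a line of $\mathcal B$ and $F_A(z)F_B(z)>0$, $|F_B(z)|<|F_A(z)|$. For a line $L\in\mathcal H\cup\mathcal V$ and a set $B$, the light count of $L\cap B$ is the number of distinct points of $L\cap B$ that are light points of some unit segment contained in $L$, where a light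 point that is the midpoint of a horizontal unit segment is counted twice. Blocks: let $\Lambda$ be the lattice in $\mathbb Z^2$ generated by $(\omega^2,0)$ and $(0,\omega)$; a block is a square $[0,\omega]^2+\ell$ with $\ell\in\Lambda$. *)

(* Defs.v *)
From HB Require Import structures.
From mathcomp Require Import all_boot all_order all_algebra.
From mathcomp Require Import reals.
Set Implicit Arguments. Unset Strict Implicit. Unset Printing Implicit Defensive.
Import Order.TTheory GRing.Theory Num.Theory.
Local Open Scope ring_scope.

Section EvenRational.
Variable R : realType.
Variables p q : nat.

(* representative of x mod 2Z in (-1,1] *)
Definition mod2 (x : R) : R := x - 2 * (Num.ceil ((x - 1) / 2))%:~R.

Definition omega : nat := (p + q)%N.
Definition Pc : R := 2 * p%:R / omega%:R.
Definition Qc : R := 2 * q%:R / omega%:R.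

Definition FH (z : R * R) : R := mod2 (2 * Pc * z.2).
Definition FV (z : R * R) : R := mod2 (2 * Pc * z.1).
Definition FP (z : R * R) : R := mod2 (Pc * z.2 + Pc ^+ 2 * z.1 + 1).
Definition FQ (z : R * R) : R := mod2 (Pc * z.2 + Pc * Qc * z.1 + 1).

Definition on_family_line (B : R) (z : R * R) : Prop :=
  exists c : int, z.2 = - B * z.1 + c%:~R.

Inductive hvline := HLine of int | VLine of int.

Definition on_line (L : hvline) (z : R * R) : Prop :=
  match L with
  | HLine n => z.2 = n%:~R
  | VLine n => z.1 = n%:~R
  end.

(* capacity |omega F_A(L)|, F_A being constant on L; evaluated at a point of L *)
Definition capacity (L : hvline) : R :=
  match L with
  | HLine n => `|omega%:R * FH (0, n%:~R)|
  | VLine n => `|omega%:R * FV (n%:~R, 0)|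
  end.

Inductive useg := HSeg of int & int | VSeg of int & int.

Definition in_useg (s : useg) (z : R * R) : Prop :=
  match s with
  | HSeg m n => z.2 = n%:~R /\ m%:~R <= z.1 <= m%:~R + 1
  | VSeg m n => z.1 = m%:~R /\ n%:~R <= z.2 <= n%:~R + 1
  end.

Definition FA (s : useg) : R * R -> R :=
  match s with HSeg _ _ => FH | VSeg _ _ => FV end.

Definition light_cond (F : R * R -> R) (B : R) (FB : R * R -> R) (z : R * R) :=
  on_family_line B z /\ 0 < F z * FB z /\ `|FB z| < `|F z|.

Definition light_point (s : useg) (z : R * R) : Prop :=
  in_useg s z /\
  (light_cond (FA s) Pc FP z \/ light_cond (FA s) Qc FQ z).

Definition useg_in_line (s : useg) (L : hvline) : Prop :=
  forall z, in_useg s z -> on_line L z.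

Definition in_block (a b : int) (z : R * R) : Prop :=
  (a * (omega ^ 2)%N)%:~R <= z.1 <= (a * (omega ^ 2)%N)%:~R + omega%:R /\
  (b * omega)%:~R <= z.2 <= (b * omega)%:~R + omega%:R.

Definition line_meets_block (a b : int) (L : hvline) : Prop :=
  exists z, on_line L z /\ in_block a b z.

Definition is_hmidpoint (z : R * R) : Prop :=
  exists m n : int, z = (m%:~R + 2^-1, n%:~R).

Definition light_in (a b : int) (L : hvline) (z : R * R) : Prop :=
  on_line L z /\ in_block a b z /\
  exists s, useg_in_line s L /\ light_point s z.

Definition light_count_is (a b : int) (L : hvline) (k : nat) : Prop :=
  exists s1 s2 : seq (R * R),
    uniq s1 /\ uniq s2 /\
    (forall z, z \in s1 <-> light_in a b L z /\ ~ is_hmidpoint z) /\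
    (forall z, z \in s2 <-> light_in a b L z /\ is_hmidpoint z) /\
    (size s1 + 2 * size s2)%N = k.

End EvenRational.

(* Main.v *)
Require Import Defs.
From HB Require Import structures.
From mathcomp Require Import all_boot all_order all_algebra.
From mathcomp Require Import reals.
From mathcomp Require Import ring lra zify.
Import Order.TTheory GRing.Theory Num.Theory.
Local Open Scope ring_scope.

(* Let w = p + q, which is odd. Along a line of slope -P or -Q the function F_P,
   resp. F_Q, is constant and depends only on the intercept c, through the residue
   r = p c + (w - 1) / 2 mod w; along a line of H or V of index n the function F_H,
   resp. F_V, depends only on u = 2 p n mod w. Capacity k means u = k / 2 or
   u = w - k / 2, and the crossing point is light exactly when r < u (in the first
   case) or r >= u (in the second). Since c |-> r is a bijection mod w, among w
   consecutive intercepts exactly k / 2 are light.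
   On a vertical line each of the two families contributes one full period of
   intercepts, and the two sets of points are disjoint unless u = 0.
   On a horizontal line the intercepts are n, ..., n + 2p for P and n, ..., n + 2q
   for Q. Lightness is invariant under n + i |-> n - i, so the second range may be
   replaced by n + 2p, ..., n + 2w; the two ranges together make two periods, with
   the classes of n and n + 2p hit once more. That excess is absorbed by the two
   ends of the segment, which lie on both families and are counted once. The only
   other common point is the midpoint of the segment; it is the only light point
   that is the midpoint of a unit segment, so it is rightly counted twice. *)

(** * Representatives modulo 2 *)

Lemma mod2_eq (R : realType) (x y : R) (t : int) :
  -1 < y <= 1 -> x = y + 2 * t%:~R -> mod2 x = y.
Proof.
move=> /andP[y_gt y_le] ->; rewrite /mod2.
rewrite (_ : Num.ceil _ = t) ?addrK //.
by apply: ceil_def; rewrite rmorphB /=; lra.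
Qed.

Lemma mod2_ratio (R : realType) (w : nat) (N t : int) :
  (- w%:Z < N <= w%:Z) ->
  mod2 ((N + 2 * t * w%:Z)%:~R / w%:R : R) = N%:~R / w%:R.
Proof.
move=> /andP[N_gt N_le].
have w_gt0 : 0 < w%:R :> R by rewrite ltr0n; lia.
have NgtR : - w%:R < N%:~R :> R by rewrite -[w%:R]/(w%:~R) -rmorphN ltr_int.
have NleR : N%:~R <= w%:R :> R by rewrite -[w%:R]/(w%:~R) ler_int.
apply: (@mod2_eq _ _ _ t); first by rewrite ltr_pdivlMr // ler_pdivrMr //; lra.
by rewrite !(rmorphD, rmorphM) /=; field; rewrite lt0r_neq0.
Qed.

(** * Arithmetic modulo the odd weight [w] *)

Section Residues.
Variables p q : nat.
Hypothesis cop_pq : coprime p q.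
Hypothesis even_pq : ~~ odd (p * q).
Hypotheses (p_gt0 : (0 < p)%N) (q_gt0 : (0 < q)%N).
Let w := (p + q)%N.

(** Two odd parameters would make [p * q] odd; two even ones would share the factor 2. *)
Lemma odd_weight : odd w.
Proof.
move: cop_pq even_pq; rewrite /w oddD oddM.
case p_odd: (odd p); case q_odd: (odd q) => //=.
rewrite /coprime => /eqP pq1 _.
have : (2 %| gcdn p q)%N by rewrite dvdn_gcd !dvdn2 p_odd q_odd.
by rewrite pq1.
Qed.

Let w_half : w%:Z = 2 * (w./2)%:Z + 1.
Proof. by have := odd_double_half w; rewrite odd_weight -muln2; lia. Qed.

Let w_gt0 : 0 < w%:Z. Proof. by rewrite /w; lia. Qed.
Let w_neq0 : w%:Z != 0. Proof. by rewrite gt_eqF. Qed.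

Lemma coprime_weight : coprime p w.
Proof. by rewrite /coprime gcdnDl. Qed.

(* [F_H] on [y = n] and [F_V] on [x = n] equal [2 * line_res n / w] mod 2. *)
Definition line_res (n : int) : int := ((2 * p%:Z * n) %% (p + q)%N)%Z.

(* [F_P], resp. [F_Q], equals [(2 * point_res c + 1) / w] mod 2 all along the
   line of slope [- P], resp. [- Q], and intercept [c]. *)
Definition point_res (c : int) : int := ((p%:Z * c + ((p + q)./2)%:Z) %% (p + q)%N)%Z.

(** The Boolean equality merges the two sign cases of lightness: [r < u] when the value on the line
    is nonnegative, [r >= u] when it is negative. *)
Definition good (n c : int) : bool :=
  (point_res c < line_res n) == (2 * line_res n < (p + q)%N%:Z).

Lemma line_res_bounds n : 0 <= line_res n < w%:Z.
Proof. by rewrite modz_ge0 // ltz_pmod. Qed.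

Lemma point_res_bounds c : 0 <= point_res c < w%:Z.
Proof. by rewrite modz_ge0 // ltz_pmod. Qed.

Lemma point_resDM (t c : int) : point_res (c + t * w%:Z) = point_res c.
Proof.
rewrite /point_res -/w.
by rewrite (_ : _ + _ = p%:Z * t * w%:Z + (p%:Z * c + w./2%:Z)) ?modzMDl //; ring.
Qed.

Lemma goodDM (n t c : int) : good n (c + t * w%:Z) = good n c.
Proof. by rewrite /good point_resDM. Qed.

Lemma line_res0 n c : line_res n = 0 -> good n c = false.
Proof.
move=> n0; rewrite /good n0; have := point_res_bounds c; rewrite -/w; lia.
Qed.

(* The residues at [n + i] and [n - i] add up to [line_res n - 1] modulo [w]. *)
Lemma good_reflect n i : good n (n + i) = good n (n - i).
Proof.
have /andP[u0 uw] := line_res_bounds n.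
have /andP[r0 rw] := point_res_bounds (n + i).
have /andP[s0 sw] := point_res_bounds (n - i).
have : point_res (n - i) = ((line_res n - 1 - point_res (n + i)) %% w%:Z)%Z.
  rewrite {1}/point_res -/w.
  have Du := divz_eq (2 * p%:Z * n) w%:Z; rewrite -/(line_res n) in Du.
  have Dr := divz_eq (p%:Z * (n + i) + w./2%:Z) w%:Z.
  rewrite -/(point_res (n + i)) in Dr.
  move: Du Dr; set d := divz _ _; set e := divz _ _ => Du Dr.
  (* The two numerators add up to [2 * p * n + w - 1], whence the [1] in the quotient and the [- 1]
     in the remainder. *)
  rewrite (_ : _ + _ = (d - e + 1) * w%:Z + (line_res n - 1 - point_res (n + i))).
    by rewrite modzMDl.
  by move: w_half; lia.
case: (ltrP (point_res (n + i)) (line_res n)) => ltru.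
  rewrite modz_small; last by lia.
  by rewrite /good -/w => ->; lia.
rewrite -modzDl modz_small; last by lia.
by rewrite /good -/w => ->; lia.
Qed.

Lemma eqz_mod_weight (m1 m2 : int) :
  (p%:Z * m1 = p%:Z * m2 %[mod w%:Z])%Z -> (m1 = m2 %[mod w%:Z])%Z.
Proof.
move/eqP; rewrite eqz_mod_dvd -mulrBr Gauss_dvdzr; last first.
  by rewrite coprimezE coprime_sym coprime_weight.
by rewrite -eqz_mod_dvd => /eqP.
Qed.

(** Over a full period the residues take each value [0, ..., w - 1] once, so it remains to count the
    integers below [u], or those from [u] on. *)
Lemma count_good (n c : int) :
  count (good n \o (fun i : nat => c + i%:Z)) (iota 0 w) =
  absz (if 2 * line_res n < w%:Z then line_res n else w%:Z - line_res n).
Proof.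
have /andP[u0 uw] := line_res_bounds n.
set u := line_res n in u0 uw *.
have res_perm : perm_eq [seq `|point_res (c + i%:Z)|%N | i <- iota 0 w] (iota 0 w).
  have res_uniq : uniq [seq `|point_res (c + i%:Z)|%N | i <- iota 0 w].
    rewrite map_inj_in_uniq ?iota_uniq // => i j; rewrite !mem_iota => iw jw eq_res.
    have : point_res (c + i%:Z) = point_res (c + j%:Z).
      have := point_res_bounds (c + i%:Z); have := point_res_bounds (c + j%:Z).
      by lia.
    rewrite /point_res -/w => /eqP.
    rewrite eqz_modDr => /eqP /eqz_mod_weight /eqP.
    rewrite eqz_modDl => /eqP.
    by rewrite !modz_small; lia.
  apply: uniq_perm (iota_uniq _ _) _ => //.
  have [||//] := uniq_min_size res_uniq (s2 := iota 0 w); rewrite ?size_map //.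
  move=> _ /mapP[i _ ->]; rewrite mem_iota.
  by have := point_res_bounds (c + i%:Z); lia.
pose f (r : nat) := (r%:Z < u) == (2 * u < w%:Z).
transitivity (count f (iota 0 w)).
  rewrite -[RHS](permP res_perm) count_map; apply: eq_count => i /=.
  rewrite /f /good -/u -/w gez0_abs //.
  by case/andP: (point_res_bounds (c + i%:Z)).
have -> : iota 0 w = iota 0 `|u| ++ iota `|u| (w - `|u|).
  by rewrite -iotaD subnKC //; lia.
rewrite count_cat; case: (ltrP (2 * u) w%:Z) => u_w.
  rewrite (eq_in_count (a2 := predT)) => [|r]; last first.
    by rewrite mem_iota /f u_w /= => ?; lia.
  rewrite count_predT size_iota (eq_in_count (a2 := pred0)) ?count_pred0 ?addn0 //.
  by move=> r; rewrite mem_iota /f u_w /= => ?; lia.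
rewrite (eq_in_count (a2 := pred0)) => [|r]; last first.
  by rewrite mem_iota /f /= => ?; lia.
rewrite count_pred0 (eq_in_count (a2 := predT)); last first.
  by move=> r; rewrite mem_iota /f /= => ?; lia.
by rewrite count_predT size_iota; lia.
Qed.

(** A closed window of [w + 1] integers meets each residue class once, except that class 0 occurs at
    both ends. *)
Lemma block_quot (d x : int) :
  0 <= x < w%:Z -> 0 <= d * w%:Z + x <= w%:Z -> d = 0 \/ d = 1 /\ x = 0.
Proof.
move=> x_in; case: d => [[|[|d]]|d] dx_in; [by left | by right; lia | exfalso..].
  by have : 0 <= d%:Z * w%:Z by []; lia.
by have : 0 <= d%:Z * w%:Z by []; lia.
Qed.

(** As [2 * p] is invertible modulo [w], the residues [k / 2] and [- k / 2] come from single
    classes, those of [E] and [- E]. For [k = 0] the classes coincide and the two lines are the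
    opposite ends of the window. *)
Lemma exists_lines (e : int) (k : nat) : ~~ odd k -> (k <= w)%N ->
  exists n1 n2 : int, n1 <> n2 /\
    forall n : int,
      (e * w%:Z <= n <= e * w%:Z + w%:Z /\
         (2 * line_res n = k%:Z \/ 2 * line_res n = 2 * w%:Z - k%:Z))
      <-> (n = n1 \/ n = n2).
Proof.
move=> k_even k_le.
have k_half : k%:Z = 2 * (k./2)%:Z.
  by have := odd_double_half k; rewrite (negbTE k_even) -muln2; lia.
have cop_2p : coprimez (2 * p%:Z) w%:Z.
  rewrite coprimezE abszM /= coprimeMl coprime_weight andbT.
  by rewrite coprime2n odd_weight.
have [[v v'] /= vP] := coprimezP _ _ cop_2p.
(* Here [v] is a Bezout inverse of [2 * p] modulo [w]. *)
set E := ((v * k./2%:Z) %% w%:Z)%Z.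
have E_ge0 : 0 <= E by rewrite modz_ge0.
have E_lt : E < w%:Z by rewrite ltz_pmod.
have E_res : ((2 * p%:Z * E) %% w%:Z)%Z = k./2%:Z.
  rewrite modzMmr (_ : _ * _ = - (v' * k./2%:Z) * w%:Z + k./2%:Z).
    by rewrite modzMDl modz_small //; move: w_half; lia.
  by have := congr1 ( *%R^~ k./2%:Z) vP; rewrite /= mul1r; lia.
(* The two indices differ because [w] is odd and so is not [2 * E]. *)
exists (e * w%:Z + E), (e * w%:Z + w%:Z - E); split=> [|n]; first by move: w_half; lia.
have dvd_diff (m : int) :
    (2 * p%:Z * n = 2 * p%:Z * m %[mod w%:Z])%Z -> exists j : int, n - m = j * w%:Z.
  move/eqP; rewrite eqz_mod_dvd -mulrBr Gauss_dvdzr; last by rewrite coprimez_sym.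
  by case/dvdzP=> j; exists j.
have /andP[u0 uw] := line_res_bounds n.
split.
  case=> n_in [Du | Du].
    have /dvd_diff[j] : (2 * p%:Z * n = 2 * p%:Z * E %[mod w%:Z])%Z.
      by rewrite E_res -/(line_res n); lia.
    move=> Dj; have : j - e = 0 \/ j - e = 1 /\ E = 0 by apply: block_quot; lia.
    by case=> [j_e | [j_e E0]]; [left | right]; rewrite (_ : j = e + (j - e)) ?j_e in Dj; lia.
  have /dvd_diff[j] : (2 * p%:Z * n = 2 * p%:Z * (- E) %[mod w%:Z])%Z.
    rewrite mulrN -modzNm E_res -/(line_res n) -modzDl modz_small; last by lia.
    by lia.
  move=> Dj; have : e + 1 - j = 0 \/ e + 1 - j = 1 /\ E = 0 by apply: block_quot; lia.
  by case=> [j_e | [j_e E0]]; [right | left]; rewrite (_ : j = e + 1 - (e + 1 - j)) ?j_e in Dj; lia.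
have res_shift (j m : int) : line_res (j * w%:Z + m) = ((2 * p%:Z * m) %% w%:Z)%Z.
  by rewrite /line_res -/w mulrDr mulrA modzMDl.
case=> ->.
  by rewrite res_shift E_res; split; lia.
rewrite (_ : e * w%:Z + w%:Z - E = (e + 1) * w%:Z + (- E)); last by ring.
rewrite res_shift mulrN -modzNm E_res.
case: (posnP k./2) => [k0 | k_gt0]; first by rewrite k0 oppr0 mod0z; split; lia.
by rewrite -modzDl modz_small; [split; lia | move: w_half; lia].
Qed.

(** * From real values to residues *)

Section RealFieldModel.
Variable R : realType.
Let wR_gt0 : 0 < w%:R :> R. Proof. by rewrite ltr0n addn_gt0 p_gt0. Qed.
Let wR_neq0 : w%:R != 0 :> R. Proof. by rewrite lt0r_neq0. Qed.

Lemma mod2_line n :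
  mod2 (2 * Pc R p q * n%:~R) =
  (if 2 * line_res n < w%:Z then 2 * line_res n
   else 2 * line_res n - 2 * w%:Z)%:~R / w%:R.
Proof.
have /andP[u0 uw] := line_res_bounds n.
have Du := divz_eq (2 * p%:Z * n) w%:Z; rewrite -/(line_res n) in Du.
set d := divz _ _ in Du.
transitivity (mod2 ((2 * (2 * p%:Z * n))%:~R / w%:R : R)).
  by congr mod2; rewrite /Pc /omega -/w !rmorphM /=; field.
rewrite Du; case: ltrP => u_w.
  rewrite -[RHS](@mod2_ratio _ _ _ d); last by lia.
  by congr (mod2 (_%:~R / _)); ring.
rewrite -[RHS](@mod2_ratio _ _ _ (d + 1)); last by move: w_half; lia.
by congr (mod2 (_%:~R / _)); ring.
Qed.

(** Writing [1] as [(2 * w./2 + 1) / w] explains the shift by [w./2] in [point_res] and the odd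
    numerator. *)
Lemma mod2_point (c : int) :
  mod2 (Pc R p q * c%:~R + 1) =
  (if 2 * point_res c < w%:Z then 2 * point_res c + 1
   else 2 * point_res c + 1 - 2 * w%:Z)%:~R / w%:R.
Proof.
have /andP[r0 rw] := point_res_bounds c.
have Dr := divz_eq (p%:Z * c + w./2%:Z) w%:Z; rewrite -/(point_res c) in Dr.
set d := divz _ _ in Dr.
transitivity (mod2 ((2 * (p%:Z * c + w./2%:Z) + 1)%:~R / w%:R : R)).
  rewrite (_ : _ + 1 = 2 * p%:Z * c + w%:Z); last by move: w_half; lia.
  by congr mod2; rewrite /Pc /omega -/w intrD !intrM; field.
rewrite Dr; case: ltrP => u_w.
  rewrite -[RHS](@mod2_ratio _ _ _ d); last by move: w_half; lia.
  by congr (mod2 (_%:~R / _)); ring.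
rewrite -[RHS](@mod2_ratio _ _ _ (d + 1)); last by move: w_half; lia.
by congr (mod2 (_%:~R / _)); ring.
Qed.

(** The numerator for the line is even and the one for the intercept is odd, so their absolute
    values never tie. Conversely, [r < u] with [2 * u < w], or [r >= u] with [2 * u >= w], already
    forces equal signs. *)
Lemma good_light n c :
  let f := mod2 (2 * Pc R p q * n%:~R) in let g := mod2 (Pc R p q * c%:~R + 1) in
  (0 < f * g /\ `|g| < `|f|) <-> good n c.
Proof.
move=> /=; rewrite mod2_line mod2_point !normrM !normfV.
set K := (if _ then _ else _); set J := (if _ then _ else _).
rewrite ltr_pM2r ?invr_gt0 ?normr_gt0 // mulrACA -invfM.
have ww_gt0 : 0 < (w%:R * w%:R)^-1 :> R by rewrite invr_gt0 mulr_gt0.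
rewrite (pmulr_lgt0 _ ww_gt0) -intrM ltr0z -!intr_norm ltr_int.
have sign_mul (x y : int) : (0 < x * y) = ((0 < x) && (0 < y) || (x < 0) && (y < 0)).
  case: (ltrgtP 0 x) => [x0|x0|<-] /=; last by rewrite mul0r ltxx.
    by rewrite pmulr_rgt0 // orbF.
  by rewrite nmulr_rgt0.
rewrite sign_mul /good /K /J -/w.
have := line_res_bounds n; have := point_res_bounds c; rewrite -/w.
move: (line_res n) (point_res c) w_half => u r.
case: (ltrP (2 * u)) => ?; case: (ltrP (2 * r)) => ? ? ? ?; split; lia.
Qed.

Lemma capacity_res n (k : nat) :
  `|w%:R * mod2 (2 * Pc R p q * n%:~R)| = k%:R <->
  (2 * line_res n = k%:Z \/ 2 * line_res n = 2 * w%:Z - k%:Z) /\ (k <= w)%N.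
Proof.
rewrite mod2_line mulrCA divff // mulr1 -intr_norm -[k%:R]/(k%:Z%:~R).
have := line_res_bounds n; rewrite -/w => u_bounds.
split=> [/intr_inj | ?].
  by case: ltrP; lia.
congr (_%:~R); case: ltrP; move: w_half; lia.
Qed.

Lemma ex_nat_lt (x : int) (m : nat) :
  -1 < x < m%:Z -> exists2 i : nat, (i < m)%N & x = i%:Z.
Proof. by case: x => [i|i] // /andP[_ im]; exists i. Qed.

Lemma count_good_capacity (n c : int) (k : nat) :
  (k <= w)%N -> 2 * line_res n = k%:Z \/ 2 * line_res n = 2 * w%:Z - k%:Z ->
  (2 * count (good n \o (fun i : nat => (c + i%:Z)%R)) (iota 0 w))%N = k.
Proof.
move=> k_le u_k; rewrite count_good; have := line_res_bounds n; rewrite -/w.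
by case: (ltrP (2 * line_res n)); move: w_half; lia.
Qed.

Definition line_index (L : hvline) : int := match L with HLine n => n | VLine n => n end.

(** Substituting the equation of a line of either family cancels the terms in [x], so [FP] and [FQ]
    both become the class of [Pc * c + 1]. *)
Lemma light_in_good a b L (z : R * R) :
  light_in p q a b L z <->
  on_line L z /\ in_block p q a b z /\
  exists c : int, good (line_index L) c /\
    (z.2 = - Pc R p q * z.1 + c%:~R \/ z.2 = - Qc R p q * z.1 + c%:~R).
Proof.
have FP_line (c : int) : z.2 = - Pc R p q * z.1 + c%:~R ->
    FP p q z = mod2 (Pc R p q * c%:~R + 1).
  by move=> zc; congr mod2; rewrite zc; ring.
have FQ_line (c : int) : z.2 = - Qc R p q * z.1 + c%:~R ->
    FQ p q z = mod2 (Pc R p q * c%:~R + 1).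
  by move=> zc; congr mod2; rewrite zc; ring.
split=> [[zL [zB [s [sL [zs zlight]]]]] | [zL [zB [c [c_good zc]]]]].
  split=> //; split=> //.
  have FsE : FA p q s z = mod2 (2 * Pc R p q * (line_index L)%:~R).
    (* A segment perpendicular to [L] is impossible: both its ends would have the coordinate [n]. *)
    case: L s sL zL zs {zlight} => n [] m n' sL /= zL zs.
    - by rewrite /FH zL.
    - have e0 : n'%:~R = n%:~R :> R by apply: (sL (m%:~R, n'%:~R)); split=> //=; lra.
      suff : n'%:~R + 1 = n%:~R :> R by lra.
      by apply: (sL (m%:~R, n'%:~R + 1)); split=> //=; lra.
    - have e0 : m%:~R = n%:~R :> R by apply: (sL (m%:~R, n'%:~R)); split=> //=; lra.
      suff : m%:~R + 1 = n%:~R :> R by lra.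
      by apply: (sL (m%:~R + 1, n'%:~R)); split=> //=; lra.
    - by rewrite /FV zL.
  by case: zlight => -[[c zc] light]; exists c; (split; [apply/good_light | auto]);
    rewrite -FsE; [rewrite -FP_line | rewrite -FQ_line].
split=> //; split=> //.
have floor_seg (x : R) : (Num.floor x)%:~R <= x <= (Num.floor x)%:~R + 1.
  by have /andP[-> /ltW] := floor_itv x; rewrite intrD.
(* Any unit segment of [L] through [z] serves, as [F_A] is constant on [L]; rounding down the free
   coordinate gives one. *)
pose s := match L with
          | HLine n => HSeg (Num.floor z.1) n
          | VLine n => VSeg n (Num.floor z.2)
          end.
exists s; have /good_light /= light := c_good.
split; first by rewrite /s; case: L {zL light c_good s} => n y /= [].
split; first by rewrite /s; case: L zL {light c_good s} => n /= zL; split.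
have FsE : FA p q s z = mod2 (2 * Pc R p q * (line_index L)%:~R).
  by rewrite /s; case: L zL {light c_good s} => n /= zL; rewrite /FH /FV zL.
rewrite /light_cond FsE.
by case: zc => zc; [left | right]; (split; first by exists c);
  rewrite ?(FP_line _ zc) ?(FQ_line _ zc).
Qed.

(** * Light points on vertical lines *)

(** Write [P * n = d + U] with [U = u / w] in [[0, 1)]. As [P + Q = 2], the two families cross
    [x = n] at heights congruent to [- U] and [U] modulo 1. *)
Lemma light_count_vertical (a b n : int) (k : nat) :
  (k <= w)%N -> 2 * line_res n = k%:Z \/ 2 * line_res n = 2 * w%:Z - k%:Z ->
  line_meets_block R p q a b (VLine n) -> light_count_is R p q a b (VLine n) k.
Proof.
move=> k_le u_k [z0 [/= z0n [z0x _]]]; rewrite z0n in z0x.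
have := divz_eq (2 * p%:Z * n) w%:Z; rewrite -/(line_res n).
set d := divz _ _ => Du; have /andP[u_ge0 u_lt] := line_res_bounds n.
set u := line_res n in Du u_ge0 u_lt u_k.
pose U : R := u%:~R / w%:R.
have U_ge0 : 0 <= U by rewrite divr_ge0 ?ler0z ?ler0n.
have U_lt1 : U < 1 by rewrite ltr_pdivrMr // mul1r -[w%:R]/(w%:Z%:~R) ltr_int.
have PnE : Pc R p q * n%:~R = d%:~R + U.
  rewrite /Pc /U /omega -/w; transitivity ((2 * p%:Z * n)%:~R / w%:R : R).
    by rewrite !intrM; field.
  by rewrite Du intrD intrM; field.
have QnE : Qc R p q * n%:~R = 2 * n%:~R - d%:~R - U.
  rewrite -addrA -opprD -PnE /Pc /Qc /omega -/w.
  have -> : q%:R = w%:R - p%:R :> R by rewrite /w natrD addrAC subrr add0r.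
  by field.
have bwE : (b * omega p q)%:~R = b%:~R * w%:R :> R by rewrite intrM.
(* For [U > 0] the indices [i < w] give all crossings in the block. For [U = 0] each list misses one
   end of the block, but then no intercept is good. *)
pose yP (i : nat) : R * R := (n%:~R, b%:~R * w%:R + 1 + i%:R - U).
pose yQ (i : nat) : R * R := (n%:~R, b%:~R * w%:R + i%:R + U).
pose cP : int := d + b * w%:Z + 1.
pose cQ : int := 2 * n - d + b * w%:Z.
pose gP (i : nat) := good n (cP + i%:Z).
pose gQ (i : nat) := good n (cQ + i%:Z).
have u_neq0 c : good n c -> u != 0.
  by apply: contraTneq => u0; rewrite line_res0.
have not_mid (z : R * R) : z.1 = n%:~R -> ~ is_hmidpoint z.
  move=> zn [m [m' zE]]; move: zn; rewrite zE /= => half.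
  have : (2 * m + 1)%:~R = (2 * n)%:~R :> R by rewrite intrD !intrM -half; field.
  by move/intr_inj; lia.
exists ([seq yP i | i <- iota 0 w & gP i] ++ [seq yQ i | i <- iota 0 w & gQ i]), [::].
split.
  rewrite cat_uniq !map_inj_uniq ?filter_uniq ?iota_uniq //=; first last.
  - by move=> i j [] /addIr /addrI /eqP; rewrite eqr_nat => /eqP.
  - by move=> i j [] /addIr /addrI /eqP; rewrite eqr_nat => /eqP.
  rewrite andbT; apply/hasPn => _ /mapP[j j_in ->].
  move: j_in; rewrite mem_filter => /andP[/u_neq0 u0 _].
  apply/negP => /mapP[i _ [eq_y]].
  (* A common point would give [2 * u = (i + 1 - j) * w] with [0 < 2 * u < 2 * w], hence
     [2 * u = w], against the oddness of [w]. *)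
  have : (2 * u)%:~R = ((i%:Z + 1 - j%:Z) * w%:Z)%:~R :> R.
    rewrite !intrM intrB intrD.
    rewrite (_ : i%:Z%:~R + 1 - j%:Z%:~R = 2 * U); last by move: eq_y; rewrite -!pmulrn; lra.
    by rewrite /U; field.
  move/intr_inj => u2; have : 0 < (i%:Z + 1 - j%:Z) * w%:Z < 2 * w%:Z by lia.
  rewrite pmulr_lgt0 // ltr_pM2r // => ij.
  by move: u2; rewrite (_ : i%:Z + 1 - j%:Z = 1); move: w_half; lia.
split=> //; split.
  move=> z; rewrite mem_cat.
  split.
    have yU (y : R) : b%:~R * w%:R <= y <= b%:~R * w%:R + w%:R ->
      in_block p q a b (n%:~R, y) by split=> //=; rewrite bwE.
    case/orP=> /mapP[i i_in ->]; move: i_in; rewrite mem_filter mem_iota add0n => /andP[ig iw].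
      split; last exact: not_mid.
      have iwR : i.+1%:R <= w%:R :> R by rewrite ler_nat; case/andP: iw.
      apply/light_in_good; split=> //; split.
        apply: yU; move: iwR (ler0n R i); rewrite -natr1; lra.
      by exists (cP + i%:Z); split=> //; left; rewrite /= mulNr PnE /cP !intrD intrM; ring.
    split; last exact: not_mid.
    have iwR : i.+1%:R <= w%:R :> R by rewrite ler_nat; case/andP: iw.
    apply/light_in_good; split=> //; split.
      apply: yU; move: iwR (ler0n R i); rewrite -natr1; lra.
    by exists (cQ + i%:Z); split=> //; right; rewrite /= mulNr QnE /cQ !intrD intrN !intrM; ring.
  case=> /light_in_good[/= zn [[_ zy] [c [c_good zc]]]] _.
  have u_gt0 : 0 < u by rewrite lt_neqAle eq_sym (u_neq0 c) .
  have U_gt0 : 0 < U by rewrite divr_gt0 ?ltr0z.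
  rewrite bwE zn in zy zc.
  case: zc => zc; apply/orP; [left | right]; apply/mapP.
    have : -1 < c - cP < w%:Z.
      rewrite -!(ltr_int R) !intrD !intrN !intrD intrM; move: zc zy; rewrite mulNr PnE; lra.
    case/ex_nat_lt=> i iw /(canRL (subrK _)); rewrite addrC => cE; exists i.
      by rewrite mem_filter mem_iota add0n iw !andbT /gP -cE.
    rewrite cE in zc; rewrite [z]surjective_pairing zn zc /yP.
    by congr pair; rewrite /= mulNr PnE /cP !intrD intrM; ring.
  have : -1 < c - cQ < w%:Z.
    rewrite -!(ltr_int R) !intrD !intrN !intrD intrN !intrM; move: zc zy; rewrite mulNr QnE; lra.
  case/ex_nat_lt=> i iw /(canRL (subrK _)); rewrite addrC => cE; exists i.
    by rewrite mem_filter mem_iota add0n iw !andbT /gQ -cE.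
  rewrite cE in zc; rewrite [z]surjective_pairing zn zc /yQ.
  by congr pair; rewrite /= mulNr QnE /cQ !intrD intrN !intrM; ring.
split=> [z|].
  by split=> // -[[zn _] /(not_mid _ zn)].
rewrite muln0 addn0 size_cat !size_map !size_filter.
have countP : (2 * count gP (iota 0 w))%N = k := count_good_capacity n cP k k_le u_k.
have countQ : (2 * count gQ (iota 0 w))%N = k := count_good_capacity n cQ k k_le u_k.
by apply/eqP; rewrite -(eqn_pmul2l (isT : (0 < 2)%N)) mulnDr countP countQ addnn mul2n.
Qed.

(** * Light points on horizontal lines *)

(* Where the line of slope [- 2 * d / w] and intercept [n + i], up to a multiple
   of [w], meets [y = n]; the families [d = p] and [d = q] meet it at common
   points exactly for [i] in [{0, d, 2 * d}]. *)
Definition crossing (x0 n : int) (d i : nat) : R * R :=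
  (x0%:~R + i%:R * w%:R / (2 * d%:R), n%:~R).

Lemma crossing_inj (x0 n : int) (d : nat) : (0 < d)%N -> injective (crossing x0 n d).
Proof.
move=> d_gt0 i j [] /addrI; rewrite -!mulrA => /mulIf ij.
apply/eqP; rewrite -(eqr_nat R); apply/eqP/ij.
by rewrite mulf_neq0 // invr_eq0 mulf_neq0 // pnatr_eq0 -lt0n.
Qed.

Lemma crossing_eq (x0 n : int) (d e i j : nat) : (0 < d)%N -> (0 < e)%N ->
  (crossing x0 n d i = crossing x0 n e j) <-> (i * e = j * d)%N.
Proof.
move=> d_gt0 e_gt0.
have d0 : d%:R != 0 :> R by rewrite pnatr_eq0 -lt0n.
have e0 : e%:R != 0 :> R by rewrite pnatr_eq0 -lt0n.
split=> [[] /addrI ij | ij].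
  apply/eqP; rewrite -(eqr_nat R) !natrM.
  have -> : i%:R * e%:R = i%:R * w%:R / (2 * d%:R) * (2 * d%:R * e%:R / w%:R) :> R.
    by field; rewrite wR_neq0.
  by rewrite ij; apply/eqP; field; rewrite wR_neq0.
congr (_ + _, _); have := congr1 (fun x : nat => x%:R : R) ij; rewrite !natrM => ijR.
transitivity (i%:R * e%:R * (w%:R / (2 * d%:R * e%:R)) : R); first by field; apply/andP.
by rewrite ijR; field; apply/andP.
Qed.

(** If the offset [i * w / (2 * d)] is half an odd integer, then [i * w] is an odd multiple of [d].
    Coprimality gives [i = t * d] with [t <= 2], and [t * w] odd leaves [t = 1]. *)
Lemma crossing_midpoint (x0 n : int) (d i : nat) :
  (0 < d)%N -> coprime d w -> (i <= 2 * d)%N ->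
  is_hmidpoint (crossing x0 n d i) <-> i = d.
Proof.
move=> d_gt0 cop_dw i_le.
have d0 : d%:R != 0 :> R by rewrite pnatr_eq0 -lt0n.
split=> [[m [m' [xm _]]] | ->].
  have xm_int : i%:Z * w%:Z = d%:Z * (2 * m + 1 - 2 * x0).
    apply: (@intr_inj R); rewrite !(intrM, intrD, intrN).
    transitivity (((x0%:~R + i%:R * w%:R / (2 * d%:R)) - x0%:~R) * (2 * d%:R) : R).
      by rewrite addrAC subrr add0r divfK // mulf_neq0 // pnatr_eq0.
    by rewrite xm; field.
  have /dvdnP[t it] : (d %| i)%N.
    rewrite -(Gauss_dvdl _ cop_dw).
    suff : (d%:Z %| (i * w)%N%:Z)%Z by [].
    by rewrite PoszM xm_int dvdz_mulr // dvdzz.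
  move: xm_int; rewrite it PoszM -mulrA mulrCA => /(mulfI _) tw.
  have {}tw : t%:Z * w%:Z = 2 * m + 1 - 2 * x0 by apply: tw; rewrite eqz_nat -lt0n.
  have : (t <= 2)%N by rewrite -(leq_pmul2r d_gt0) -it.
  by case: t {it xm} tw => [|[|[|//]]] tw _; move: w_half; lia.
exists (x0 + w./2%:Z), n; congr pair.
have -> : w%:R = 2 * (w./2)%:R + 1 :> R.
  by have := congr1 (fun x : int => x%:~R : R) w_half; rewrite /= intrD intrM.
by rewrite intrD; field.
Qed.

(** Since [x0] is a multiple of [w ^ 2], it shifts the intercept by [2 * d * a * w], a multiple of
    [w] that [good] ignores. Traversing the width [w] then raises the intercept by [2 * d]. *)
Lemma light_in_crossing a b n (z : R * R) :
  line_meets_block R p q a b (HLine n) ->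
  let x0 := a * (w ^ 2)%N%:Z in
  light_in p q a b (HLine n) z <->
  exists d i : nat, [/\ (d == p) || (d == q), (i <= 2 * d)%N, good n (n + i%:Z)
                      & z = crossing x0 n d i].
Proof.
case=> z0 [/= z0n [_ z0y]]; rewrite z0n in z0y; set x0 := a * _.
have x0E : x0 = a * w%:Z * w%:Z by rewrite /x0 expnS expn1 PoszM mulrA.
have slope (d : nat) c : 0 < d%:R :> R ->
    in_block p q a b z /\ z.2 = - (2 * d%:R / w%:R) * z.1 + c%:~R /\ z.2 = n%:~R /\ good n c <->
    exists i : nat, [/\ (i <= 2 * d)%N, good n (n + i%:Z), z = crossing x0 n d i
      & c = n + i%:Z + 2 * d%:Z * a * w%:Z].
  move=> d_gt0.
  have dw_gt0 : 0 < 2 * d%:R / w%:R :> R by rewrite divr_gt0 // mulr_gt0.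
  have x0R : x0%:~R = a%:~R * w%:R * w%:R :> R by rewrite x0E !intrM.
  split=> [[[/= zx _] [zc [zn c_good]]] | [i [i_le i_good zE cE]]].
    have cE : (c - n - 2 * d%:Z * a * w%:Z)%:~R = (z.1 - x0%:~R) * (2 * d%:R / w%:R) :> R.
      rewrite x0R !intrD !intrN !intrM -zn.
      rewrite (_ : c%:~R = z.2 + 2 * d%:R / w%:R * z.1); last by rewrite zc; ring.
      by field.
    have : -1 < c - n - 2 * d%:Z * a * w%:Z < (2 * d).+1%:Z.
      rewrite -!(ltr_int R) cE; apply/andP; split.
        apply: (@lt_le_trans _ _ 0); first by rewrite ltrN10.
        by rewrite mulr_ge0 ?(ltW dw_gt0) // subr_ge0; case/andP: zx.
      apply: (@le_lt_trans _ _ (2 * d)%:R); last by rewrite ltr_nat.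
      have -> : (2 * d)%:R = w%:R * (2 * d%:R / w%:R) :> R by rewrite natrM; field.
      by rewrite ler_pM2r // lerBlDl; case/andP: zx.
    case/ex_nat_lt=> i i_le iE; exists i.
    have cnE : c = n + i%:Z + 2 * d%:Z * a * w%:Z by rewrite -iE; ring.
    split=> //; first by move: c_good; rewrite cnE goodDM.
    rewrite [z]surjective_pairing zn; congr pair.
    rewrite iE in cE; rewrite [i%:R]cE; field.
    by rewrite wR_neq0 lt0r_neq0.
  have d0 : d%:R != 0 :> R by rewrite lt0r_neq0.
  have zn : z.2 = n%:~R by rewrite zE.
  split; last split.
  - split; last by rewrite zn.
    rewrite zE /= -/x0 lerDl lerD2l divr_ge0 ?mulr_ge0 ?ler0n //=.
    rewrite ler_pdivrMr ?mulr_gt0 // mulrC ler_pM2l //.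
    by rewrite -natrM ler_nat.
  - rewrite zE cE /= x0R !intrD !intrM; field.
    by rewrite wR_neq0 d0.
  - by split=> //; rewrite cE goodDM.
have p_gt0R : 0 < p%:R :> R by rewrite ltr0n.
have q_gt0R : 0 < q%:R :> R by rewrite ltr0n.
split=> [/light_in_good[zn [zB [c [c_good [zc | zc]]]]] | [d [i [dpq i_le i_good zE]]]].
- have /(slope _ _ p_gt0R)[i [*]] := conj zB (conj zc (conj zn c_good)).
  by exists p, i; rewrite eqxx.
- have /(slope _ _ q_gt0R)[i [*]] := conj zB (conj zc (conj zn c_good)).
  by exists q, i; rewrite eqxx orbT.
apply/light_in_good; case/orP: dpq => /eqP dE; rewrite {}dE in i_le zE.
  have [|zB [zc [zn c_good]]] := proj2 (slope _ (n + i%:Z + 2 * p%:Z * a * w%:Z) p_gt0R).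
    by exists i.
  by do 2!split=> //; exists (n + i%:Z + 2 * p%:Z * a * w%:Z); auto.
have [|zB [zc [zn c_good]]] := proj2 (slope _ (n + i%:Z + 2 * q%:Z * a * w%:Z) q_gt0R).
  by exists i.
by do 2!split=> //; exists (n + i%:Z + 2 * q%:Z * a * w%:Z); auto.
Qed.

Lemma count_neq (T : eqType) (P : pred T) (x : T) (s : seq T) : uniq s -> x \in s ->
  count P s = (P x + count (fun y => P y && (y != x)) s)%N.
Proof.
by move=> s_uniq /perm_to_rem /permP -> /=; rewrite rem_filter // count_filter.
Qed.

(** The second range omits its ends, which as points are the ends of the first. Reflection sends
    [1, ..., 2 * q - 1] to [2 * p + 1, ..., 2 * w - 1], completing two periods. *)
Lemma count_good_crossings n (k : nat) :
  (k <= w)%N -> 2 * line_res n = k%:Z \/ 2 * line_res n = 2 * w%:Z - k%:Z ->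
  let N := good n \o (fun i : nat => n + i%:Z) in
  (count N (iota 0 (2 * p).+1) + count N (iota 1 (2 * q).-1))%N = k.
Proof.
move=> k_le u_k N.
have N_shift (i j : nat) : N (i + w)%N = N i by rewrite /N /= -[RHS](goodDM n 1); congr good; lia.
have N_refl (j : nat) : (j <= 2 * w)%N -> N (2 * w - j)%N = N j.
  move=> j_le; rewrite /N /= [RHS]good_reflect -[RHS](goodDM n 2); congr good; lia.
have -> : count N (iota 1 (2 * q).-1) = count N (iota (2 * p).+1 (2 * q).-1).
  transitivity (count N [seq (2 * w - j)%N | j <- iota 1 (2 * q).-1]).
    rewrite count_map; apply: eq_in_count => j; rewrite mem_iota /= => j_in.
    by rewrite N_refl //; lia.
  apply/permP/uniq_perm; rewrite ?iota_uniq // ?map_inj_in_uniq ?iota_uniq //.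
    by move=> i j; rewrite !mem_iota /w; lia.
  move=> j; rewrite mem_iota; apply/mapP/idP => [[i] | j_in].
    by rewrite mem_iota /w => i_in ->; lia.
  by exists (2 * w - j)%N; rewrite ?mem_iota /w; move: j_in; lia.
rewrite -count_cat -iotaD (_ : _ + _ = w + w)%N; last by rewrite /w; lia.
rewrite iotaD count_cat add0n (_ : iota w w = map (addn w) (iota 0 w)); last first.
  by rewrite -iotaDl addn0.
rewrite count_map (@eq_count _ (preim _ N) N); last by move=> i /=; rewrite addnC N_shift.
by rewrite addnn -mul2n; apply: count_good_capacity.
Qed.

(** The common midpoint is removed from both families and restored with weight two, so the total of
    [count_good_crossings] is unchanged. *)
Lemma light_count_horizontal (a b n : int) (k : nat) :
  (k <= w)%N -> 2 * line_res n = k%:Z \/ 2 * line_res n = 2 * w%:Z - k%:Z ->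
  line_meets_block R p q a b (HLine n) -> light_count_is R p q a b (HLine n) k.
Proof.
move=> k_le u_k /light_in_crossing; set x0 := a * _ => lightE.
have cop_qw : coprime q w by rewrite /w /coprime gcdnDr gcdnC.
pose N := good n \o (fun i : nat => n + i%:Z).
have countE : (count N (iota 0 (2 * p).+1) + count N (iota 1 (2 * q).-1))%N = k.
  exact: count_good_crossings.
(* Modulo [w], [- p] is [q] and [- 2 * p] is [2 * q], so reflection matches the middles and the far
   ends of the two ranges. *)
have N_mid : N p = N q.
  by rewrite /N /= [LHS]good_reflect -[LHS](goodDM n 1); congr good; rewrite /w; lia.
have N_end : N (2 * p)%N = N (2 * q)%N.
  by rewrite /N /= [LHS]good_reflect -[LHS](goodDM n 2); congr good; rewrite /w; lia.
have cP i j := crossing_eq x0 n p q i j p_gt0 q_gt0.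
have midP i := crossing_midpoint x0 n p i p_gt0 coprime_weight.
have midQ j := crossing_midpoint x0 n q j q_gt0 cop_qw.
exists ([seq crossing x0 n p i | i <- iota 0 (2 * p).+1 & N i && (i != p)] ++
        [seq crossing x0 n q j | j <- iota 1 (2 * q).-1 & N j && (j != q)]).
exists (if N p then [:: crossing x0 n p p] else [::]).
(* A common crossing means [i * q = j * p], so [q] divides [j]; strictly between 0 and [2 * q] this
   leaves only [j = q]. *)
have no_common (i j : nat) : (0 < j < 2 * q)%N -> j != q -> crossing x0 n p i <> crossing x0 n q j.
  move=> j_in jq /cP ij.
  have /dvdnP[t jE] : (q %| j)%N.
    by rewrite -(@Gauss_dvdl q _ p) 1?coprime_sym // -ij dvdn_mull.
  by case: t jE => [|[|t]] jE; move: j_in jq; rewrite jE ?mul1n ?eqxx //; nia.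
split; [|split; [|split; [|split]]].
- rewrite cat_uniq !map_inj_uniq ?filter_uniq ?iota_uniq //; try exact: crossing_inj.
  rewrite andbT; apply/hasPn => _ /mapP[j j_in ->].
  move: j_in; rewrite mem_filter mem_iota => /andP[/andP[_ jq] j_in].
  by apply/negP => /mapP[i _ /esym/no_common]; apply=> //; lia.
- by case: (N p).
- move=> z; rewrite mem_cat; split.
    case/orP=> /mapP[i i_in ->]; move: i_in; rewrite mem_filter mem_iota.
      move=> /andP[/andP[Ni /eqP ip] i_in]; have i_le : (i <= 2 * p)%N by lia.
      by split=> [|/(midP i i_le)//]; apply/lightE; exists p, i; rewrite eqxx.
    move=> /andP[/andP[Ni /eqP iq] i_in]; have i_le : (i <= 2 * q)%N by lia.
    by split=> [|/(midQ i i_le)//]; apply/lightE; exists q, i; rewrite eqxx orbT.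
  case=> /lightE[d [i [/orP[]/eqP-> i_le Ni ->]]] not_mid.
    apply/orP; left; apply: map_f; rewrite mem_filter mem_iota [N i]Ni /= add0n ltnS i_le andbT.
    by apply/eqP => ip; apply: not_mid; apply/midP.
  have iq : i != q by apply/eqP => iq; apply: not_mid; apply/midQ.
  (* The two end crossings of the family [Q] are found in the list of the family [P]. *)
  case: (posnP i) => [i0 | i_gt0].
    rewrite i0 -(proj2 (cP 0 0)%N) //; apply/orP; left; apply: map_f.
    by rewrite mem_filter mem_iota /= -i0 [N i]Ni i0 /= eq_sym -lt0n p_gt0.
  case: (eqVneq i (2 * q)%N) => [i2q | i2q].
    rewrite i2q -(proj2 (cP (2 * p) (2 * q))%N) //; last by lia.
    apply/orP; left; apply: map_f.
    by rewrite mem_filter mem_iota N_end -i2q [N i]Ni /=; lia.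
  by apply/orP; right; apply: map_f; rewrite mem_filter mem_iota [N i]Ni iq /=; lia.
- move=> z; split.
    case Np: (N p) => //; rewrite inE => /eqP ->; split.
      by apply/lightE; exists p, p; split; rewrite ?eqxx //; lia.
    by apply/midP => //; lia.
  case=> /lightE[d [i [/orP[]/eqP-> i_le Ni ->]]].
    by move/(midP i i_le) => ip; have Np : N i := Ni; rewrite ip in Np *; rewrite Np inE.
  move/(midQ i i_le) => iq; have Nq : N i := Ni; rewrite iq in Nq *.
  by rewrite N_mid Nq inE; apply/eqP/esym/cP; rewrite mulnC.
rewrite size_cat !size_map !size_filter -[RHS]countE.
have p_in : p \in iota 0 (2 * p).+1 by rewrite mem_iota; lia.
have q_in : q \in iota 1 (2 * q).-1 by rewrite mem_iota; lia.
rewrite (count_neq _ N p _ (iota_uniq _ _) p_in) (count_neq _ N q _ (iota_uniq _ _) q_in).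
by rewrite -N_mid; case: (N p) => /=; lia.
Qed.

(** * Lines meeting a block, and the final assembly *)

(** The corner coordinates [b * w] and [(a * w) * w] are both multiples of [w], so the windows of
    [exists_lines] serve both directions. *)
Lemma line_meets_blockP (a b : int) (L : hvline) :
  line_meets_block R p q a b L <->
  let e := match L with HLine _ => b | VLine _ => a * w%:Z end in
  e * w%:Z <= line_index L <= e * w%:Z + w%:Z.
Proof.
have x0E : a * (omega p q ^ 2)%N%:Z = a * w%:Z * w%:Z.
  by rewrite expnS expn1 PoszM mulrA.
have wZ : w%:R = w%:Z%:~R :> R by [].
split; case: L => n.
- by case=> z [/= zn [_ zy]]; move: zy; rewrite zn wZ -intrD !ler_int.
- by case=> z [/= zn [zx _]]; move: zx; rewrite zn x0E wZ -intrD !ler_int.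
- move=> /= n_in; exists ((a * (omega p q ^ 2)%N)%:~R, n%:~R); split=> //.
  by split=> /=; rewrite ?lexx ?lerDl ?ler0n // wZ -intrD !ler_int.
- move=> /= n_in; exists (n%:~R, (b * omega p q)%:~R); split=> //.
  by split=> /=; rewrite ?lexx ?lerDl ?ler0n // x0E wZ -intrD !ler_int.
Qed.

Lemma capacityP L (k : nat) :
  capacity R p q L = k%:R <->
  (2 * line_res (line_index L) = k%:Z \/ 2 * line_res (line_index L) = 2 * w%:Z - k%:Z)
  /\ (k <= w)%N.
Proof. by case: L => n; apply: capacity_res. Qed.

End RealFieldModel.

End Residues.

Theorem theorem2p5 (R : realType) (p q : nat) (a b : int) (k : nat) :
  (0 < p)%N -> (p < q)%N -> coprime p q -> ~~ odd (p * q) ->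
  ~~ odd k -> (k <= p + q)%N ->
  (exists n1 n2 : int, n1 <> n2 /\
     forall n : int,
       (line_meets_block R p q a b (HLine n) /\ capacity R p q (HLine n) = k%:R)
       <-> (n = n1 \/ n = n2)) /\
  (exists n1 n2 : int, n1 <> n2 /\
     forall n : int,
       (line_meets_block R p q a b (VLine n) /\ capacity R p q (VLine n) = k%:R)
       <-> (n = n1 \/ n = n2)) /\
  (forall L : hvline,
     line_meets_block R p q a b L -> capacity R p q L = k%:R ->
     light_count_is R p q a b L k).
Proof.
move=> p_gt0 p_lt_q cop_pq even_pq k_even k_le.
have q_gt0 : (0 < q)%N := ltn_trans p_gt0 p_lt_q.
have meetsP := line_meets_blockP p q R a b.
have capP := capacityP _ _ cop_pq even_pq p_gt0 q_gt0 R.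
have lines e := exists_lines _ _ cop_pq even_pq p_gt0 q_gt0 e k k_even k_le.
split; [|split].
- have [n1 [n2 [n12 nP]]] := lines b; exists n1, n2; split=> // n; split.
    by case=> /meetsP n_in /(proj1 (capP _ _))[n_res _]; apply/nP.
  by move/nP=> [n_in n_res]; split; [apply/meetsP | apply/(proj2 (capP _ _))].
- have [n1 [n2 [n12 nP]]] := lines (a * (p + q)%N%:Z); exists n1, n2; split=> // n; split.
    by case=> /meetsP n_in /(proj1 (capP _ _))[n_res _]; apply/nP.
  by move/nP=> [n_in n_res]; split; [apply/meetsP | apply/(proj2 (capP _ _))].
- case=> n meets /(proj1 (capP _ _))[n_res _]; by [apply: light_count_horizontal | apply: light_count_vertical].
Qed.
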